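(* Let $d$ be a nonnegative integer and suppose there is a polynomial identity in $\mathbb{R}[x]$ of the form $$\sum_{i=1}^k \alpha_i (x+x_i)^d = \sum_{i=1}^l \beta_i (x+y_i)^{e_i},$$ where $x_1,\ldots,x_k$ are distinct real constants, the real constants $\alpha_1,\ldots,\alpha_k$ are not all zero, the $\beta_i$ and $y_i$ are arbitrary real constants, and the $e_i$ are nonnegative integers with $e_i < d$ for every $i$. Then $k+l > (d+2)/2$. *)

(* Defs.v *)
From HB Require Import structures.
From mathcomp Require Export all_boot all_order all_algebra.
From mathcomp Require Export reals.

(* Main.v *)
Require Import Defs.
From mathcomp Require Import all_boot all_order all_algebra.
From mathcomp Require Import reals.
From mathcomp Require Import polyrcf zify lra.
Set Implicit Arguments.
Unset Strict Implicit.
Unset Printing Implicit Defensive.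
Import Order.TTheory GRing.Theory Num.Theory.
Local Open Scope ring_scope.

(** Replacing every power [(X - a_i)^e_i] of a vanishing linear combination by
    the truncated power supported on [t >= a_i] gives a compactly supported
    spline. By Rolle, one differentiation increases by one the length of an
    alternating sequence of values, except that each jump of the function
    costs at most two; the jumps of the [j]-th derivative are the knots with
    [e_i = j]. Hence the [d]-th derivative takes alternating signs at
    [d + 1 - 2 l] or more points, whereas it is a compactly supported step
    function with at most [k] jumps, so that [d + 2 <= k + 2 l]. *)

(** * Derivatives of powers, and alternating sequences *)

Lemma derivn_exp_XsubC (R : comNzRingType) (a : R) n j :
  (('X - a%:P) ^+ n)^`(j) = ('X - a%:P) ^+ (n - j) *+ n ^_ j.
Proof.
elim: j => [|j IHj]; first by rewrite subn0.
rewrite derivnS IHj derivMn deriv_exp derivXsubC mul1r -mulrnA -subnS.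
by rewrite ffactnSr mulnC.
Qed.

Lemma right_gap (R : realFieldType) (s : seq R) (t : R) :
  exists2 v, t < v & {in s, forall z, t < z -> v < z}.
Proof.
elim: s => [|z s [v tv IHs]]; first by exists (t + 1); rewrite ?ltrDl.
have [zt|tz] := leP z t.
  exists v => // w; rewrite inE => /orP[/eqP-> /(le_lt_trans zt)|/IHs//].
  by rewrite ltxx.
exists (Num.min v ((t + z) / 2)); first by rewrite lt_min tv; lra.
move=> w; rewrite inE => /orP[/eqP-> _|/IHs vw /vw {}vw]; rewrite gt_min.
  by apply/orP; right; lra.
by rewrite vw.
Qed.

(* [g] is either [fun _ => f] (values of [f]) or [fun u v => f v - f u]
   (increments of [f]). *)
Fixpoint alternating (R : rcfType) (g : R -> R -> R) (u : R) (b : bool)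
    (s : seq R) : Prop :=
  if s is v :: s' then
    [/\ u < v, 0 < (-1) ^+ b * g u v & alternating g v (~~ b) s']
  else True.

(** Between values of opposite sign, the increment has the sign of the later value; the final return
    to zero beyond [M] adds one more increment. That last increment must be strict, hence the
    condition on [f u] when [s] is empty. *)
Lemma alternating_values_increments (R : rcfType) (f : R -> R) (M : R) :
  (forall t, M <= t -> f t = 0) ->
  forall (s : seq R) u (b : bool), (-1) ^+ b * f u <= 0 -> (s != [::]) || ((-1) ^+ b * f u < 0) ->
  alternating (fun _ => f) u b s ->
  exists2 s', size s' = (size s).+1 &
    alternating (fun v w => f w - f v) u b s'.
Proof.
move=> f0; elim=> [|v s IHs] u b /= fu_le fu_lt.
  move=> _; exists [:: Num.max (u + 1) M] => //=; split => //.
    by rewrite lt_max ltrDl ltr01.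
  by rewrite f0 ?le_max ?lexx ?orbT // sub0r mulrN oppr_gt0.
case=> uv fv alt_s.
have fv_lt : (-1) ^+ (~~ b) * f v < 0.
  by move: fv; case: b {fu_le fu_lt alt_s} => /=; rewrite ?expr0 ?expr1; lra.
have [|s' sz_s' alt_s'] := IHs v (~~ b) (ltW fv_lt) _ alt_s.
  by rewrite fv_lt orbT.
exists (v :: s'); rewrite /= ?sz_s' //; split => //.
by rewrite mulrBr; lra.
Qed.

Lemma alternating_values_weaken (R : rcfType) (f : R -> R) u v b s :
  u <= v -> alternating (fun _ => f) v b s -> alternating (fun _ => f) u b s.
Proof. by case: s => [|w s] //= uv [/(le_lt_trans uv)]. Qed.

(** * Splines of truncated powers, their derivatives and jumps *)

Section TruncatedPowers.

Variables (R : rcfType) (I : finType) (c a : I -> R) (e : I -> nat).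

Definition power_sum (P : pred I) : {poly R} :=
  \sum_(i | P i) c i *: ('X - (a i)%:P) ^+ e i.

(* The right-continuous [j]-th derivative of the spline
   [sum_i c_i (t - a_i)_+^e_i]. *)
Definition spline (j : nat) (t : R) : R :=
  (power_sum (fun i => a i <= t))^`(j).[t].

(** Counting only knots beyond [u] lets the count drop as an alternating sequence moves right past a
    jump. *)
Definition jumps (j : nat) (u : R) : nat :=
  #|[set i | (e i == j) && (u < a i)]|.

Lemma horner_derivn_power_sum (P : pred I) j t :
  (power_sum P)^`(j).[t]
  = \sum_(i | P i) c i * ((t - a i) ^+ (e i - j) *+ e i ^_ j).
Proof.
rewrite /power_sum linear_sum /= horner_sum; apply: eq_bigr => i _.
by rewrite derivnZ derivn_exp_XsubC hornerZ hornerMn horner_exp hornerXsubC.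
Qed.

(** Induction on the number of knots strictly between [u] and [v]: cutting at one of them, the
    spline rises (up to the sign [b]) on one of the two halves. With no knot inside and no jump at
    [v], it agrees at both ends with one polynomial, and the mean value theorem applies. *)
Lemma spline_rise_or_jump (b : bool) j u v :
  u < v -> 0 < (-1) ^+ b * (spline j v - spline j u) ->
  (exists i, [/\ e i = j, u < a i & a i <= v])
  \/ exists2 w, u < w <= v & 0 < (-1) ^+ b * spline j.+1 w.
Proof.
have [n] := ubnP #|[set i | u < a i < v]|.
elim: n u v => // n IHn u v; rewrite ltnS => card_n uv rise.
have [/existsP[i /andP[/eqP ei /andP[ui iv]]]|no_jump] :=
  boolP [exists i, (e i == j) && (u < a i <= v)]; first by left; exists i.
case: (set_0Vmem [set i | u < a i < v]) => [no_knot|[i]]; last first.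
  rewrite inE => /andP[ui iv].
  have card_lt x y : u <= x -> y <= v -> (a i <= x) || (y <= a i) ->
      (#|[set k | x < a k < y]%R| < n)%N.
    move=> ux yv ixy; apply: leq_trans card_n; apply: proper_card.
    apply/properP; split.
      apply/subsetP => k; rewrite !inE => /andP[xk ky].
      by rewrite (le_lt_trans ux xk) (lt_le_trans ky yv).
    exists i; rewrite inE ?ui ?iv // negb_and -!leNgt; exact: ixy.
  have [rise1|fall1] := ltP 0 ((-1) ^+ b * (spline j (a i) - spline j u)).
    have [|[k [ek uk ka]]|[w /andP[uw wa] sw]] := IHn _ _ _ ui rise1.
    - by apply: card_lt; rewrite ?lexx ?orbT // ltW.
    - by left; exists k; rewrite (le_trans ka (ltW iv)).
    - by right; exists w; rewrite // uw (le_trans wa (ltW iv)).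
  have rise2 : 0 < (-1) ^+ b * (spline j v - spline j (a i)).
    by move: rise fall1; rewrite !mulrBr; lra.
  have [|[k [ek uk ka]]|[w /andP[uw wa] sw]] := IHn _ _ _ iv rise2.
  - by apply: card_lt; rewrite ?lexx // ltW.
  - by left; exists k; rewrite (lt_trans ui uk).
  - by right; exists w; rewrite // (lt_trans ui uw).
set p := (power_sum (fun i => a i <= u))^`(j).
have knotP i : u < a i -> v <= a i.
  move=> ui; rewrite leNgt; apply/negP => iv.
  by have := in_set0 i; rewrite -no_knot inE ui iv.
(* A knot at [v] itself does not contribute: its power vanishes there. *)
have spline_v : spline j v = p.[v].
  rewrite /spline /p !horner_derivn_power_sum big_mkcond [RHS]big_mkcond /=.
  apply: eq_bigr => i _; have [iu|ui] := leP (a i) u.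
    by rewrite (le_trans iu (ltW uv)).
  case: ifP => // iv; have av : a i = v by apply/le_anti; rewrite iv knotP.
  have eij : e i != j.
    by apply: contra no_jump => eij; apply/existsP; exists i; rewrite eij ui.
  rewrite av subrr; case: (ltnP (e i) j) => [lt_ej|le_je].
    by rewrite ffact_small // mulr0n mulr0.
  rewrite expr0n subn_eq0 leqNgt ltn_neqAle eq_sym eij le_je /=.
  by rewrite mul0rn mulr0.
have [w wuv mvt] := poly_mvt p uv.
move: wuv; rewrite in_itv /= => /andP[uw wv].
right; exists w; first by rewrite uw ltW.
have -> : spline j.+1 w = p^`().[w].
  rewrite /spline /p -derivnS !horner_derivn_power_sum; apply: eq_bigl => i.
  have [iu|ui] := leP (a i) u; first by rewrite (le_trans iu (ltW uw)).
  by apply/negbTE; rewrite -ltNge (lt_le_trans wv (knotP _ ui)).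
move: rise; rewrite spline_v -[spline j u]/(p.[u]) mvt mulrA pmulr_lgt0 //.
by rewrite subr_gt0.
Qed.

Lemma jumps_lt j u v i : e i = j -> u < a i -> a i <= v ->
  (jumps j v < jumps j u)%N.
Proof.
move=> ei ui iv; apply: proper_card; apply/properP; split.
  apply/subsetP => k; rewrite !inE => /andP[-> vk].
  exact: lt_trans (lt_le_trans ui iv) vk.
by exists i; rewrite inE ei eqxx ?ui // -leNgt.
Qed.

Lemma jumps_le j u v : u <= v -> (jumps j v <= jumps j u)%N.
Proof.
move=> uv; apply/subset_leq_card/subsetP => k; rewrite !inE => /andP[-> vk].
exact: le_lt_trans uv vk.
Qed.

(* If the sign [b'] at which the new sequence starts differs from [b], one
   alternation is gained; this bookkeeping is what makes the induction work. *)
Lemma alternating_spline_deriv j s u b :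
  alternating (fun v w => spline j w - spline j v) u b s ->
  exists b' s', alternating (fun _ => spline j.+1) u b' s' /\
    (size s + (b' != b) <= size s' + 2 * jumps j u)%N.
Proof.
elim: s u b => [|v s IHs] u b /=.
  by move=> _; exists b, [::]; rewrite eqxx.
case=> uv rise /IHs[b' [s' [alt_s' size_s']]].
have alt_u := alternating_values_weaken (ltW uv) alt_s'.
have [[i [ei ui iv]]|[w /andP[uw wv] sw]] := spline_rise_or_jump uv rise.
  (* The two units released by the jump pay for the lost point and for a possible change of starting
     sign. *)
  exists b', s'; split=> //; have := jumps_lt ei ui iv.
  by move: size_s'; case: (b' != b); case: (b' != ~~ b) => /=; lia.
have jumps_vu := jumps_le j (ltW uv).
(* Either [w] can be prepended, or [s'] already starts with sign [b] and the induction hypothesis,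
   stated for [~~ b], has gained the unit. *)
have [eb|nb] := eqVneq b' (~~ b).
  exists b, (w :: s') => /=; split; last by rewrite eqxx /=; lia.
  by split=> //; rewrite -eb; apply: alternating_values_weaken alt_s'.
have eb : b' = b by case: b b' nb {rise size_s' alt_s' alt_u sw} => [] [].
exists b', s'; split=> //; move: size_s'; rewrite eb eqxx.
by have -> : (b != ~~ b) = true by [case: (b)]; lia.
Qed.

(** For a step function every increment needs a jump of its own, so at the top order a jump costs
    one instead of two. *)
Lemma alternating_spline_jumps j s u b :
  (forall t, spline j.+1 t = 0) ->
  alternating (fun v w => spline j w - spline j v) u b s ->
  (size s <= jumps j u)%N.
Proof.
move=> deriv0; elim: s u b => [|v s IHs] u b //= [uv rise /IHs size_s].
have [[i [ei ui iv]]|[w _]] := spline_rise_or_jump uv rise.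
  exact: leq_ltn_trans size_s (jumps_lt ei ui iv).
by rewrite deriv0 mulr0 ltxx.
Qed.

(** The polynomial piece at [t] has a nonzero [j]-th derivative and stays in force up to the next
    knot; just right of [t] the finitely many roots are avoided. *)
Lemma spline_neq0_antideriv j n t : (j <= n)%N -> spline n t != 0 ->
  exists2 v, t <= v & spline j v != 0.
Proof.
move=> jn; rewrite /spline; set q := power_sum _ => qn0.
have q_neq0 : q^`(j) != 0.
  apply: contra qn0 => /eqP qj0.
  rewrite -(subnKC jn) /derivn addnC iterD -/(derivn j q) qj0.
  by rewrite -/(derivn (n - j) 0) linear0 horner0.
have [v tv gap] := right_gap (codom a ++ rootsR q^`(j)) t.
exists v; first exact: ltW.
have -> : power_sum (fun i => a i <= v) = q.
  apply: eq_bigl => i; have [it|ti] := leP (a i) t.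
    by rewrite (le_trans it (ltW tv)).
  by apply/negbTE; rewrite -ltNge gap // mem_cat codom_f.
apply/negP => rv; have := gap v; rewrite mem_cat.
have -> : v \in rootsR q^`(j).
  by rewrite -(roots_on_rootsR q_neq0) in_itv.
by rewrite orbT ltxx => /(_ isT tv).
Qed.

(** Both sides of the identity are merged into one family, the exponent telling them apart. Knots
    are counted by index, so those of lower degree may coincide. *)
Theorem vanishing_power_sum_bound (d : nat) :
  (forall i, (e i <= d)%N) ->
  {in [pred i | e i == d] &, injective a} ->
  (exists2 i, e i = d & c i != 0) ->
  \sum_i c i *: ('X - (a i)%:P) ^+ e i = 0 ->
  (d + 2 <= #|[set i | e i == d]| + 2 * #|[set i | (e i < d)%N]|)%N.
Proof.
move=> e_le a_inj [i0 ei0 ci0] sum0.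
pose m := \sum_i `|a i|.
have norm_le i : `|a i| <= m.
  by rewrite /m (bigD1 i) //= lerDl sumr_ge0.
have m_ge i : - m <= a i by have := norm_le i; rewrite ler_norml => /andP[].
have m_le i : a i <= m by have := norm_le i; rewrite ler_norml => /andP[].
have spline_right j t : m <= t -> spline j t = 0.
  move=> mt; rewrite /spline /power_sum (eq_bigl predT) => [|i].
    by rewrite sum0 linear0 horner0.
  by rewrite (le_trans (m_le i) mt).
pose u := - m - 1.
have u_lt i : u < a i by have := m_ge i; rewrite /u; lra.
have spline_left j t : t <= u -> spline j t = 0.
  move=> tu; rewrite /spline horner_derivn_power_sum big_pred0 // => i.
  by apply/negbTE; rewrite -ltNge (le_lt_trans tu (u_lt i)).
have [t0 spline_t0] : exists t, spline d t != 0.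
  (* At the leftmost knot of degree [d] with nonzero coefficient, no other term contributes: the
     value is that coefficient times [d!]. *)
  pose P := [pred i | (e i == d) && (c i != 0)].
  have Pi0 : P i0 by rewrite /= ei0 eqxx ci0.
  case: (arg_minP a Pi0) => i /andP[/eqP ei ci] i_min.
  exists (a i); rewrite /spline horner_derivn_power_sum (bigD1 i) //= big1.
    rewrite ei subnn expr0 addr0 ffactnn mulf_neq0 // pnatr_eq0.
    by rewrite -lt0n fact_gt0.
  move=> k /andP[ki k_neq_i]; have [ek|ek] := eqVneq (e k) d; last first.
    by rewrite ffact_small ?mulr0n ?mulr0 // ltn_neqAle ek e_le.
  have [->|ck] := eqVneq (c k) 0; first by rewrite mul0r.
  have ik : a i <= a k by apply: i_min; rewrite /= ek eqxx ck.
  case/negP: k_neq_i; apply/eqP/a_inj; rewrite ?inE ?ek ?ei //.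
  by apply/le_anti; rewrite ki.
have nonzero j : (j <= d)%N -> exists b t, alternating (fun _ => spline j) u b [:: t].
  move=> /spline_neq0_antideriv /(_ spline_t0)[t _ st].
  have ut : u < t by rewrite ltNge; apply: contra st => /spline_left->.
  exists (spline j t < 0), t; split=> //.
  by rewrite -normrEsign normr_gt0.
have increments j b (s : seq R) : s != [::] -> alternating (fun _ => spline j) u b s ->
    exists2 s', size s' = (size s).+1 &
      alternating (fun v w => spline j w - spline j v) u b s'.
  move=> s_neq0; apply: (@alternating_values_increments _ _ m).
    exact: spline_right.
    by rewrite spline_left // mulr0.
  by rewrite s_neq0.
have alternations j : (j <= d)%N -> exists b (s : seq R),
    [/\ s != [::], alternating (fun _ => spline j) u b s &
      (j.+1 <= size s + 2 * #|[set i | (e i < j)%N]|)%N].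
  elim: j => [|j IHj] jd.
    by have [b [t alt_t]] := nonzero 0%N jd; exists b, [:: t].
  have [b [s [s_neq0 alt_s size_s]]] := IHj (ltnW jd).
  have [s1 size_s1 /alternating_spline_deriv[b' [s' [alt_s' size_s']]]] :=
    increments _ _ _ s_neq0 alt_s.
  have card_S : (#|[set i | (e i < j.+1)%N]|
      = #|[set i | (e i < j)%N]| + jumps j u)%N.
    rewrite /jumps -cardsUI [_ :&: _](_ : _ = set0) ?cards0 ?addn0.
      by apply: eq_card => i; rewrite !inE u_lt andbT ltnS leq_eqVlt orbC.
    apply/setP => i; rewrite !inE u_lt andbT.
    by apply/negP => /andP[lt_ij /eqP eij]; rewrite eij ltnn in lt_ij.
  (* If the jumps have absorbed all alternations, one point where the derivative is nonzero restarts
     the sequence; nonemptiness is what [increments] requires at the next order. *)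
  have [s'0|s'_neq0] := eqVneq s' [::]; last first.
    by exists b', s'; split=> //; rewrite card_S; lia.
  have [b1 [t alt_t]] := nonzero _ jd; exists b1, [:: t]; split=> //.
  by move: size_s'; rewrite s'0 card_S /=; lia.
have [b [s [s_neq0 alt_s size_s]]] := alternations d (leqnn d).
have [s1 size_s1 alt_s1] := increments _ _ _ s_neq0 alt_s.
have deriv0 t : spline d.+1 t = 0.
  rewrite /spline horner_derivn_power_sum big1 // => i _.
  by rewrite ffact_small ?ltnS // mulr0n mulr0.
have := alternating_spline_jumps deriv0 alt_s1.
have -> : jumps d u = #|[set i | e i == d]|.
  by apply: eq_card => i; rewrite !inE u_lt andbT.
lia.
Qed.

End TruncatedPowers.

(** * Application to the identity *)

Theorem theorem13 (R : realType) (d k l : nat)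
    (alpha x : 'I_k -> R) (beta y : 'I_l -> R) (e : 'I_l -> nat)
    (x_inj : injective x)
    (alpha_neq0 : exists i : 'I_k, alpha i <> 0)
    (e_lt_d : forall i : 'I_l, (e i < d)%N)
    (identity : \sum_(i < k) alpha i *: ('X + (x i)%:P) ^+ d
                = \sum_(i < l) beta i *: ('X + (y i)%:P) ^+ (e i) :> {poly R}) :
  (k + l)%:R > (d + 2)%:R / 2 :> R.
Proof.
pose I := ('I_k + 'I_l)%type.
pose c (i : I) := match i with inl i => alpha i | inr i => - beta i end.
pose a (i : I) := match i with inl i => - x i | inr i => - y i end.
pose e' (i : I) := match i with inl i => d | inr i => e i end.
have [i0 /eqP alpha_i0] := alpha_neq0.
have card_l : #|[set i | e' i == d]| = k.
  rewrite -[RHS]card_ord -(card_imset predT (@inl_inj _ 'I_l)).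
  apply: eq_card => -[i|i]; rewrite inE /=.
    by rewrite eqxx imset_f.
  by rewrite ltn_eqF //; apply/esym/negbTE/negP => /imsetP[].
have card_r : #|[set i | (e' i < d)%N]| = l.
  rewrite -[RHS]card_ord -(card_imset predT (@inr_inj 'I_k _)).
  apply: eq_card => -[i|i]; rewrite inE /=.
    by rewrite ltnn; apply/esym/negbTE/negP => /imsetP[].
  by rewrite e_lt_d imset_f.
have bound : (d + 2 <= k + 2 * l)%N.
  have := @vanishing_power_sum_bound R I c a e' d.
  rewrite card_l card_r; apply.
  - by case=> i //=; apply: ltnW.
  - move=> [i|i] [j|j]; rewrite !inE /= ?(ltn_eqF (e_lt_d _)) //.
    by move=> _ _ /oppr_inj/x_inj->.
  - by exists (inl i0).
  - rewrite big_sumType /=.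
    under eq_bigr do rewrite polyCN opprK.
    rewrite identity -big_split big1 // => i _ /=.
    by rewrite polyCN opprK scaleNr subrr.
(* Strictness comes from [k > 0]: [d + 2 <= k + 2 * l < 2 * (k + l)]. *)
have k_gt0 : (0 < k)%N := leq_ltn_trans (leq0n i0) (ltn_ord i0).
rewrite ltr_pdivrMr ?ltr0n // -natrM ltr_nat.
by lia.
Qed.
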